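(* Let $\mathbf{k}$ be a field of characteristic zero, $0\neq q\in\mathbf{k}$, $n\geq 1$, and let $R=\mathcal{M}_q(n)$ be the quantum matrix algebra on generators $t^i_j$, $1\le i,j\le n$. Let $K$ and $L$ be subsets of $\{1,\ldots,n\}$ of the same cardinality and let $D^K_L=\det_q T^K_L\in R$ be the corresponding quantum minor. Then the multiplicative subset $S=S^K_L\subset R$ generated by $1$ and $D^K_L$, that is $S=\{(D^K_L)^N : N\geq 0\}$, is an Ore set in $R$: it satisfies both the left and the right Ore condition in $R$.
   Context: $\mathcal{M}_q(n)$ is the unital associative $\mathbf{k}$-algebra with generators $t^i_j$, $i,j\in\{1,\ldots,n\}$ ($i$ is the row label, $j$ the column label), modulo the relations - $t^\alpha_\gamma t^\alpha_\delta = q\, t^\alpha_\delta t^\alpha_\gamma$ for $\gamma<\delta$ (same row); - $t^\alpha_\gamma t^\beta_\gamma = q\, t^\beta_\gamma t^\alpha_\gamma$ for $\alpha<\beta$ (same column); - $t^\alpha_\gamma t^\beta_\delta - t^\beta_\delta t^\alpha_\gamma = (q-q^{-1})\, t^\beta_\gamma t^\alpha_\delta$ for $\alpha<\beta$, $\gamma<\delta$; - $t^\alpha_\gamma t^\beta_\delta - t^\beta_\delta t^\alpha_\gamma = 0$ for $\alpha<\beta$, $\gamma>\delta$. For subsets $K=\{k_1<\cdots<k_m\}$ and $L=\{l_1<\cdots<l_m\}$ of $\{1,\ldots,n\}$, $T^K_L$ is the submatrix of $T=(t^i_j)$ with rows labelled by $K$ and columns labelled by $L$, and the quantum minor is $$D^K_L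 = {\det}_q T^K_L=\sum_{\sigma\in\Sigma(m)} (-q)^{l(\sigma)}\, t^{k_1}_{l_{\sigma(1)}}\cdots t^{k_m}_{l_{\sigma(m)}},$$ where $\Sigma(m)$ is the symmetric group on $m$ letters and $l(\sigma)$ is the number of inversions of $\sigma$. A subset $S$ of a ring $R$ is multiplicative if $1\in S$ and $s,s'\in S$ implies $ss'\in S$. It satisfies the left Ore condition if for all $s\in S$ and $r\in R$ there exist $s'\in S$ and $r'\in R$ with $s'r=r's$. It satisfies the right Ore condition if it satisfies the left Ore condition in the opposite ring $R^{\mathrm{op}}$, i.e. for all $s\in S$, $r\in R$ there exist $s'\in S$, $r'\in R$ with $rs'=sr'$. In a ring without zero divisors, a left Ore set is a multiplicative subset satisfying the left Ore condition; an Ore set is a subset which is a left Ore set in both $R$ and $R^{\mathrm{op}}$. (The ring $\mathcal{M}_q(n)$ has no zero divisors.) *)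

(* Defs.v *)
From HB Require Import structures.
From mathcomp Require Import all_boot all_order all_algebra perm.
From mathcomp Require Import boolp.
From mathcomp Require Import finmap monalg.
Set Implicit Arguments.
Unset Strict Implicit.
Unset Printing Implicit Defensive.
Import GRing.Theory.
Local Open Scope ring_scope.
Local Open Scope quotient_scope.

Section OreSets.
Variables (R : pzRingType) (S : R -> Prop).

Definition mul_subset : Prop := S 1 /\ forall s s', S s -> S s' -> S (s * s').

Definition left_ore : Prop :=
  forall s r, S s -> exists s' r', S s' /\ s' * r = r' * s.

Definition left_ore_set : Prop := mul_subset /\ left_ore.

End OreSets.

(* R^c is the opposite ring of R; it has the same carrier as R. *)
Definition ore_set (R : pzRingType) (S : R -> Prop) : Prop :=
  @left_ore_set R S /\ @left_ore_set R^c S.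

Definition powers (R : pzRingType) (x : R) : R -> Prop :=
  fun y => exists N : nat, y = x ^+ N.

Inductive ideal_gen (R : pzRingType) (X : R -> Prop) : R -> Prop :=
| ideal_gen_in x of X x : ideal_gen X x
| ideal_gen0 : ideal_gen X 0
| ideal_genD x y of ideal_gen X x & ideal_gen X y : ideal_gen X (x + y)
| ideal_genMl a x of ideal_gen X x : ideal_gen X (a * x)
| ideal_genMr a x of ideal_gen X x : ideal_gen X (x * a).

(* The quotient of an algebra by the two-sided ideal generated by X. Algebras
   are nonzero by definition, so that ideal has to be proper. *)
Section AlgebraQuotient.
Variables (k : comNzRingType) (A : algType k) (X : A -> Prop).

Definition gen_ideal : {pred A} := [pred u : A | `[< ideal_gen X u >] ].

Lemma gen_idealP u : reflect (ideal_gen X u) (u \in gen_ideal).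
Proof. exact: asboolP. Qed.

Lemma gen_idealMl u v : v \in gen_ideal -> u * v \in gen_ideal.
Proof. by move=> /gen_idealP h; apply/gen_idealP/ideal_genMl. Qed.

Lemma gen_idealMr u v : u \in gen_ideal -> u * v \in gen_ideal.
Proof. by move=> /gen_idealP h; apply/gen_idealP/ideal_genMr. Qed.

Fact gen_ideal_zmod : zmod_closed gen_ideal.
Proof.
split=> [|u v /gen_idealP hu /gen_idealP hv]; apply/gen_idealP.
  exact: ideal_gen0.
by rewrite -mulN1r; apply: ideal_genD => //; apply: ideal_genMl.
Qed.

HB.instance Definition _ := GRing.isZmodClosed.Build A gen_ideal gen_ideal_zmod.

Definition alg_quot of ~ ideal_gen X 1 : Type := {ideal_quot gen_ideal}.

Hypothesis proper : ~ ideal_gen X 1.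
Local Notation Q := (alg_quot proper).

HB.instance Definition _ := GRing.Zmodule.on Q.
HB.instance Definition _ := EqQuotient.on Q.

Definition alg_pi (u : A) : Q := \pi_Q u.

Definition quot_one : Q := alg_pi 1.
Definition quot_mul (u v : Q) : Q := alg_pi (repr u * repr v).
Definition quot_scale (c : k) (u : Q) : Q := alg_pi (c *: repr u).

Lemma alg_piK (u : Q) : alg_pi (repr u) = u.
Proof. exact: reprK. Qed.

Lemma alg_piP (u : Q) : {v : A | u = alg_pi v}.
Proof. by exists (repr u); rewrite alg_piK. Qed.

Lemma alg_pi_eqP (u v : A) :
  reflect (alg_pi u = alg_pi v) (u - v \in gen_ideal).
Proof. by rewrite /alg_pi Quotient.idealrBE; apply: eqP. Qed.

Fact alg_pi_zmod : zmod_morphism alg_pi.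
Proof. by move=> u v; rewrite /alg_pi Quotient.pi_add Quotient.pi_opp. Qed.

HB.instance Definition _ := GRing.isZmodMorphism.Build A Q alg_pi alg_pi_zmod.

Lemma alg_pi_mul : {morph alg_pi : u v / u * v >-> quot_mul u v}.
Proof.
move=> u v; apply/alg_pi_eqP.
set u' := repr _; set v' := repr _.
have hu : u - u' \in gen_ideal by apply/alg_pi_eqP; rewrite alg_piK.
have hv : v - v' \in gen_ideal by apply/alg_pi_eqP; rewrite alg_piK.
have -> : u * v - u' * v' = (u - u') * v + u' * (v - v').
  by rewrite mulrBl mulrBr addrA addrNK.
by apply: rpredD; [apply: gen_idealMr | apply: gen_idealMl].
Qed.

Lemma alg_pi_scale c : {morph alg_pi : u / c *: u >-> quot_scale c u}.
Proof.
move=> u; apply/alg_pi_eqP; rewrite -scalerBr -mulr_algl gen_idealMl //.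
by apply/alg_pi_eqP; rewrite alg_piK.
Qed.

Fact quot_mulA : associative quot_mul.
Proof.
move=> u v w; case: (alg_piP u) (alg_piP v) (alg_piP w) => u' -> [v' ->] [w' ->].
by rewrite -!alg_pi_mul mulrA.
Qed.

Fact quot_mul1 : left_id quot_one quot_mul.
Proof. by move=> u; case: (alg_piP u) => u' ->; rewrite -alg_pi_mul mul1r. Qed.

Fact quot_mulr1 : right_id quot_one quot_mul.
Proof. by move=> u; case: (alg_piP u) => u' ->; rewrite -alg_pi_mul mulr1. Qed.

Fact quot_mulDl : left_distributive quot_mul +%R.
Proof.
move=> u v w; case: (alg_piP u) (alg_piP v) (alg_piP w) => u' -> [v' ->] [w' ->].
by rewrite -raddfD -!alg_pi_mul -raddfD mulrDl.
Qed.

Fact quot_mulDr : right_distributive quot_mul +%R.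
Proof.
move=> u v w; case: (alg_piP u) (alg_piP v) (alg_piP w) => u' -> [v' ->] [w' ->].
by rewrite -raddfD -!alg_pi_mul -raddfD mulrDr.
Qed.

Fact quot_one_neq0 : quot_one != 0.
Proof.
apply/eqP; rewrite -(raddf0 alg_pi) => /alg_pi_eqP.
by rewrite subr0 => /gen_idealP.
Qed.

HB.instance Definition _ := GRing.Zmodule_isNzRing.Build Q
  quot_mulA quot_mul1 quot_mulr1 quot_mulDl quot_mulDr quot_one_neq0.

Fact quot_scaleA a b u : quot_scale a (quot_scale b u) = quot_scale (a * b) u.
Proof. by case: (alg_piP u) => u' ->; rewrite -!alg_pi_scale scalerA. Qed.

Fact quot_scale1 : left_id 1 quot_scale.
Proof.
by move=> u; case: (alg_piP u) => u' ->; rewrite -alg_pi_scale scale1r.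
Qed.

Fact quot_scaleDr : right_distributive quot_scale +%R.
Proof.
move=> c u v; case: (alg_piP u) (alg_piP v) => u' -> [v' ->].
by rewrite -raddfD -!alg_pi_scale -raddfD scalerDr.
Qed.

Fact quot_scaleDl u : {morph quot_scale^~ u : a b / a + b}.
Proof.
move=> a b; case: (alg_piP u) => u' ->.
by rewrite -!alg_pi_scale -raddfD scalerDl.
Qed.

HB.instance Definition _ := GRing.Zmodule_isLmodule.Build k Q
  quot_scaleA quot_scale1 quot_scaleDr quot_scaleDl.

Fact alg_pi_monoid : monoid_morphism alg_pi.
Proof. by split=> // u v; rewrite alg_pi_mul. Qed.

Fact alg_pi_scalable : scalable alg_pi.
Proof. by move=> c u; rewrite alg_pi_scale. Qed.

HB.instance Definition _ :=
  GRing.isMonoidMorphism.Build A Q alg_pi alg_pi_monoid.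
HB.instance Definition _ :=
  GRing.isScalable.Build k A Q *:%R alg_pi alg_pi_scalable.

Fact quot_scaleAl (c : k) (u v : Q) : c *: (u * v) = (c *: u) * v.
Proof.
case: (alg_piP u) (alg_piP v) => u' -> [v' ->].
by rewrite -rmorphM -!linearZ -rmorphM scalerAl.
Qed.

HB.instance Definition _ := GRing.Lmodule_isLalgebra.Build k Q quot_scaleAl.

Fact quot_scaleAr (c : k) (u v : Q) : c *: (u * v) = u * (c *: v).
Proof.
case: (alg_piP u) (alg_piP v) => u' -> [v' ->].
by rewrite -rmorphM -!linearZ -rmorphM scalerAr.
Qed.

HB.instance Definition _ := GRing.Lalgebra_isAlgebra.Build k Q quot_scaleAr.

Lemma alg_pi_rel u : X u -> alg_pi u = 0.
Proof.
move=> Xu; rewrite -(raddf0 alg_pi); apply/alg_pi_eqP.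
by rewrite subr0; apply/gen_idealP/ideal_gen_in.
Qed.

End AlgebraQuotient.

Lemma malg_scaleAr (k : comNzRingType) (K : monomType) (c : k)
  (u v : {malg k[K]}) : c *: (u * v) = u * (c *: v).
Proof.
apply/malgP => m; rewrite mcoeffZ.
rewrite (mcoeffMrw _ (fsubset_refl _) (msuppZ_le _ _)) mcoeffMr mulr_sumr.
apply: eq_bigr => m2 _; rewrite mulr_sumr; apply: eq_bigr => m1 _.
by rewrite mcoeffZ mulrnAr mulrCA.
Qed.

(* The free associative algebra: the algebra of the free monoid of words. *)
Section FreeAlgebra.
Variables (k : comNzRingType) (I : choiceType).

Definition free_alg : Type := {malg k[{fmonom I}]}.

HB.instance Definition _ := GRing.Lalgebra.on free_alg.
HB.instance Definition _ :=
  GRing.Lalgebra_isAlgebra.Build k free_alg (@malg_scaleAr k _).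

Definition free_gen (i : I) : free_alg := << fmu i >>.

(* The constant coefficient. *)
Lemma free_coeff1 : {f : {rmorphism free_alg -> k} |
  scalable_for *%R f & forall i, f (free_gen i) = 0}.
Proof.
exists (@mcoeff {fmonom I} k mone : {rmorphism {malg k[{fmonom I}]} -> k}).
  by move=> c u; apply: mcoeffZ.
by move=> i; rewrite /= mcoeffU1 -val_eqE /= fmuE fm1.
Qed.

End FreeAlgebra.

Section QuantumMatrices.
Variables (k : fieldType) (n : nat) (q : k).

Variant qmx_rel (A : algType k) (x : 'I_n -> 'I_n -> A) : A -> Prop :=
| qmx_row (a c d : 'I_n) of (c < d)%N :
    qmx_rel x (x a c * x a d - q *: (x a d * x a c))
| qmx_col (a b c : 'I_n) of (a < b)%N :
    qmx_rel x (x a c * x b c - q *: (x b c * x a c))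
| qmx_diag (a b c d : 'I_n) of (a < b)%N & (c < d)%N :
    qmx_rel x (x a c * x b d - x b d * x a c - (q - q^-1) *: (x b c * x a d))
| qmx_anti (a b c d : 'I_n) of (a < b)%N & (d < c)%N :
    qmx_rel x (x a c * x b d - x b d * x a c).

Section Rel.
Variables (A : algType k) (x : 'I_n -> 'I_n -> A).

(* The relations have no constant term. *)
Lemma qmx_rel_proper (f : {rmorphism A -> k}) :
    scalable_for *%R f -> (forall i j, f (x i j) = 0) ->
  ~ ideal_gen (qmx_rel x) 1.
Proof.
move=> fZ fx0; suff fI u : ideal_gen (qmx_rel x) u -> f u = 0.
  by move=> /fI /eqP; rewrite rmorph1 oner_eq0.
elim=> {u} [_ [] *||u v _ fu _ fv|a u _ fu|a u _ fu].
- by rewrite rmorphB fZ !rmorphM /= !fx0 !mulr0 subr0.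
- by rewrite rmorphB fZ !rmorphM /= !fx0 !mulr0 subr0.
- by rewrite !rmorphB fZ !rmorphM /= !fx0 !mulr0 !subr0.
- by rewrite rmorphB !rmorphM /= !fx0 !mulr0 subr0.
- exact: rmorph0.
- by rewrite rmorphD fu fv addr0.
- by rewrite rmorphM /= fu mulr0.
- by rewrite rmorphM /= fu mul0r.
Qed.

Lemma qmx_rel_morph (B : algType k) (f : {lrmorphism A -> B})
    (y : 'I_n -> 'I_n -> B) :
  (forall i j, y i j = f (x i j)) ->
  (forall u, qmx_rel x u -> f u = 0) -> forall u, qmx_rel y u -> u = 0.
Proof.
move=> yE fX _ [a c d h|a b c h|a b c d h h'|a b c d h h']; rewrite !yE.
- by rewrite -!rmorphM -linearZ -rmorphB; apply/fX/qmx_row.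
- by rewrite -!rmorphM -linearZ -rmorphB; apply/fX/qmx_col.
- by rewrite -!rmorphM -linearZ -!rmorphB; apply/fX/qmx_diag.
- by rewrite -!rmorphM -rmorphB; apply/fX/qmx_anti.
Qed.

End Rel.

(* Letters are indexed by pairs (row, column). *)
Definition free_mx (i j : 'I_n) : free_alg k ('I_n * 'I_n)%type :=
  free_gen k (i, j).

Fact qmx_proper : ~ ideal_gen (qmx_rel free_mx) 1.
Proof.
have [f fZ f0] := free_coeff1 k ('I_n * 'I_n)%type.
exact: (@qmx_rel_proper _ _ f fZ (fun i j => f0 (i, j))).
Qed.

Definition qmatrix : Type := alg_quot qmx_proper.

HB.instance Definition _ := GRing.Algebra.on qmatrix.

Definition qmx_gen (i j : 'I_n) : qmatrix := alg_pi qmx_proper (free_mx i j).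

Lemma qmx_gen_rel u : qmx_rel qmx_gen u -> u = 0.
Proof.
apply: (@qmx_rel_morph _ free_mx _ (alg_pi qmx_proper)) => //.
exact: alg_pi_rel.
Qed.

End QuantumMatrices.

Definition inversions (m : nat) (s : 'S_m) : nat :=
  #|[set p : 'I_m * 'I_m | (p.1 < p.2)%N && (s p.2 < s p.1)%N]|.

(* \prod_(i < m) multiplies in increasing order of the row index i. *)
Definition qdet (k : fieldType) (q : k) (A : algType k) (m : nat)
    (T : 'M[A]_m) : A :=
  \sum_(s : 'S_m) (- q) ^+ inversions s *: \prod_(i < m) T i (s i).

(* enum_val enumerates a subset of 'I_n increasingly (see enum_val_ltn). *)
Definition qminor (k : fieldType) (n : nat) (q : k) (K L : {set 'I_n})
    (eqKL : #|K| = #|L|) : qmatrix n q :=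
  qdet q (mxsub (fun i : 'I_#|K| => enum_val i)
                (fun j : 'I_#|K| => enum_val (cast_ord eqKL j))
                (\matrix_(i < n, j < n) qmx_gen q i j)).

Lemma enum_val_ltn (n : nat) (K : {set 'I_n}) (i j : 'I_#|K|) :
  (i < j)%N -> (enum_val i < enum_val j)%N.
Proof.
move=> ij; have x0 := enum_val i.
rewrite !(enum_val_nth x0).
have tr : transitive (relpre (val : 'I_n -> nat) ltn).
  by move=> ? ? ?; apply: ltn_trans.
have hs : sorted (relpre val ltn) (enum K).
  rewrite /(enum _); apply: sorted_filter => //.
  by rewrite -enumT -sorted_map val_enum_ord iota_ltn_sorted.
by apply: (sorted_ltn_nth tr x0 hs); rewrite ?inE -?cardE ?ltn_ord.
Qed.

(* Main.v *)
Require Import Defs.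
From mathcomp Require Import all_boot all_order all_algebra.
From mathcomp Require Import perm boolp monalg zify ring.
Local Open Scope ring_scope.
Set Implicit Arguments.
Unset Strict Implicit.
Unset Printing Implicit Defensive.
Import GRing.Theory.

(** Write D for the minor with rows K and columns L, and call x an Ore element
    if for every N some product D^M x lies in R D^N. The Ore elements form a
    subring, which contains every y with D y = c y D for a scalar c, and which
    contains x as soon as it contains D x. The powers of D satisfy the left Ore
    condition when all elements are Ore elements, so it is enough to reach the
    generators t^i_j, and each of them may first be multiplied by D.

    - If i is in K and j in L, then t^i_j commutes with D (qdet_comm): a quantum
      determinant is central in the algebra of the entries of its matrix.
    - If i is in K and j is not in L, add the column j to the columns L. In the
      resulting matrix with one column too many, let D_c be the maximal minor
      that omits the column c, so that D_j = D. Repeating the row i and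
      expanding along it gives a linear relation between the products
      D_c t^i_c (pluecker_last), in which D t^i_j has a nonzero coefficient.
      For c in L the element t^i_c commutes with D, and D_c commutes with D up
      to a nonzero scalar (qcomm_maximal_minors). Hence D t^i_j is an Ore
      element, and so is t^i_j. The case of i outside K and j in L follows by
      transposition.
    - If i is not in K and j is not in L, expand the minor d with rows K + i and
      columns L + j along the row i. This writes D t^i_j as a combination of d,
      which commutes with D, and of products D_c t^i_c with c in L. Here both
      factors are Ore elements by the previous case.

    The expansions hold because a quantum determinant alternates in the rows up
    to powers of -q, and because it is invariant under transposition (qdet_tr).
    They hold for both orders of the entry and its cofactor, so D x and x D are
    reached together; this is why the argument is written for the abstract
    closure properties ore_closed, which the Ore elements of the ring and of the
    opposite ring share. The numerical coefficients only have to be nonzero,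
    except in the proof of centrality, where the row and the column expansion
    must produce the same adjugate matrix. *)

(** * Inversions and adjacent transpositions *)

(** For a permutation s, inversions s is by definition the value at s; here the
    map may also take a value several times. *)
Definition ninv (m : nat) (f : 'I_m -> nat) : nat :=
  #|[set p : 'I_m * 'I_m | (p.1 < p.2)%N && (f p.2 < f p.1)%N]|.

(** Exchanging two neighbours changes the relative order of no other pair. *)
Lemma tperm_adjacent_ltn (m : nat) (i i' x y : 'I_m) :
  i' = i.+1 :> nat -> (x, y) != (i, i') -> (x, y) != (i', i) ->
  (tperm i i' x < tperm i i' y)%N = (x < y)%N.
Proof.
rewrite !xpair_eqE -!val_eqE /= => hi h1 h2.
have hn (z w : 'I_m) : z <> w -> val z <> val w by move=> ne /val_inj.
by case: tpermP => [?|?|/hn ? /hn ?]; case: tpermP => [?|?|/hn ? /hn ?]; subst;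
  simpl in *; lia.
Qed.

Lemma ninv_tperm (m : nat) (f : 'I_m -> nat) (i i' : 'I_m) :
  i' = i.+1 :> nat -> (f i < f i')%N ->
  ninv (fun x => f (tperm i i' x)) = (ninv f).+1.
Proof.
move=> hi hf; pose t := tperm i i'.
pose phi (p : 'I_m * 'I_m) := (t p.1, t p.2).
have phiK : involutive phi by case=> x y; rewrite /phi /= !tpermK.
rewrite /ninv; set S' := [set p | _]; set S := [set p | _].
have -> : S' = (i, i') |: (phi @: S).
  apply/setP => -[x y]; rewrite (can2_imset_pre _ phiK phiK) !inE /=.
  case: (altP ((x, y) =P (i, i'))) => [[-> ->]|h1] /=.
    by rewrite tpermL tpermR hf hi ltnSn.
  case: (altP ((x, y) =P (i', i))) => [[-> ->]|h2].
    by rewrite !tpermL !tpermR hi; lia.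
  by rewrite tperm_adjacent_ltn.
rewrite cardsU1 card_imset; last exact: can_inj phiK.
rewrite (can2_imset_pre _ phiK phiK) !inE /= tpermL tpermR.
by have -> : (i' < i)%N = false by lia.
Qed.

Lemma ltn_adjacent_homo (m : nat) (f : 'I_m -> nat) :
  (forall i i' : 'I_m, i' = i.+1 :> nat -> (f i < f i')%N) ->
  forall i j : 'I_m, (i < j)%N -> (f i < f j)%N.
Proof.
move=> h i [j hj] /=; elim: j hj => // j IH hj ij.
have hj' : (j < m)%N by lia.
have hs := h (Ordinal hj') (Ordinal hj) erefl.
move: ij; rewrite ltnS leq_eqVlt => /orP[/eqP e|ij]; last first.
  exact: ltn_trans (IH hj' ij) hs.
by rewrite (_ : i = Ordinal hj') //; apply: val_inj.
Qed.

Lemma ltn_homo_leq (m : nat) (f : 'I_m -> 'I_m) :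
  (forall i j : 'I_m, (i < j)%N -> (f i < f j)%N) ->
  forall i : 'I_m, (i <= f i)%N.
Proof.
move=> h [i hi]; elim: i hi => // i IH hi.
have hi' : (i < m)%N by lia.
exact: leq_ltn_trans (IH hi') (h (Ordinal hi') (Ordinal hi) (ltnSn _)).
Qed.

Lemma perm_ltn_homo (m : nat) (s : 'S_m) :
  (forall i j : 'I_m, (i < j)%N -> (s i < s j)%N) -> s = 1%g.
Proof.
move=> hs; have hV (i j : 'I_m) : (i < j)%N -> (s^-1%g i < s^-1%g j)%N.
  move=> ij; rewrite ltnNge leq_eqVlt; apply/negP => /orP[/eqP/val_inj|/hs].
    by move/perm_inj => e; rewrite e ltnn in ij.
  by rewrite !permKV => ?; lia.
apply/permP => i; rewrite perm1; apply/val_inj/eqP => /=.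
rewrite eqn_leq ltn_homo_leq // andbT.
by have := ltn_homo_leq hV (s i); rewrite permK.
Qed.

(** Bubble sort as an induction principle: every map to an ordinal is sorted by
    exchanges of adjacent descents, unless an adjacent repetition stops it. *)
Lemma adjacent_ind (m p : nat) (P : ('I_m -> 'I_p) -> Prop) :
  (forall r : 'I_m -> 'I_p, {homo r : x y / (val x < val y)%N} -> P r) ->
  (forall (r : 'I_m -> 'I_p) (i i' : 'I_m), i' = i.+1 :> nat -> r i = r i' ->
     P r) ->
  (forall (r : 'I_m -> 'I_p) (i i' : 'I_m), i' = i.+1 :> nat -> (r i < r i')%N ->
     P r -> P (fun x => r (tperm i i' x))) ->
  forall r, P r.
Proof.
move=> hmono heq hswap r; pose v (r : 'I_m -> 'I_p) x := val (r x).
have [n] := ubnP (ninv (v r)); elim: n r => // n IH r lt_n.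
case: (EM (exists i i' : 'I_m, i' = i.+1 :> nat /\ (r i' <= r i)%N)); last first.
  move=> h; apply/hmono/ltn_adjacent_homo => i i' hi.
  by rewrite ltnNge; apply/negP => le; apply: h; exists i, i'.
case=> i [i' [hi]]; rewrite leq_eqVlt => /orP[/eqP/val_inj e|lt_r].
  exact: heq hi (esym e).
pose r' x := r (tperm i i' x).
have er : r = fun x => r' (tperm i i' x).
  by apply: funext => x; rewrite /r' tpermK.
have lt_r' : (r' i < r' i')%N by rewrite /r' tpermL tpermR.
rewrite er; apply: hswap => //; apply: IH.
by move: lt_n; rewrite er (ninv_tperm (f := v r') hi).
Qed.

(** * Quantum matrices *)

Section QuantumMatrix.
Variables (k : fieldType) (q : k) (A : algType k).

Record qmat (m n : nat) (T : 'M[A]_(m, n)) : Prop := QMat {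
  qmat_row (a : 'I_m) (c d : 'I_n) : (c < d)%N -> T a c * T a d = q *: (T a d * T a c);
  qmat_col (a b : 'I_m) (c : 'I_n) : (a < b)%N -> T a c * T b c = q *: (T b c * T a c);
  qmat_diag (a b : 'I_m) (c d : 'I_n) : (a < b)%N -> (c < d)%N ->
    T a c * T b d = T b d * T a c + (q - q^-1) *: (T b c * T a d);
  qmat_anti (a b : 'I_m) (c d : 'I_n) : (a < b)%N -> (d < c)%N ->
    T a c * T b d = T b d * T a c }.

Lemma qmat_tr (m n : nat) (T : 'M[A]_(m, n)) : qmat T -> qmat T^T.
Proof.
case=> hr hc hd ha; split=> [a c d|a b c|a b c d|a b c d] *; rewrite !mxE.
- exact: hc.
- exact: hr.
- by rewrite hd // [T c b * _]ha.
- by rewrite -ha.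
Qed.

Lemma qmat_sub (m n m' n' : nat) (T : 'M[A]_(m, n))
    (f : 'I_m' -> 'I_m) (g : 'I_n' -> 'I_n) :
  {homo f : x y / (val x < val y)%N} -> {homo g : x y / (val x < val y)%N} ->
  qmat T -> qmat (mxsub f g T).
Proof.
move=> hf hg [hr hc hd ha]; split=> *; rewrite !mxE.
- by apply: hr; apply: hg.
- by apply: hc; apply: hf.
- by apply: hd; [apply: hf | apply: hg].
- by apply: ha; [apply: hf | apply: hg].
Qed.

Lemma lift_homo (n : nat) (i : 'I_n) : {homo lift i : x y / (val x < val y)%N}.
Proof. by move=> x y /=; rewrite /bump; do 2 case: leqP => ? /=; lia. Qed.

Lemma qmat_row' (m n : nat) (T : 'M[A]_(m.+1, n)) (i : 'I_m.+1) :
  qmat T -> qmat (row' i T).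
Proof. by rewrite row'Esub; apply: qmat_sub => // x y; apply: lift_homo. Qed.

Lemma qmat_col' (m n : nat) (T : 'M[A]_(m, n.+1)) (j : 'I_n.+1) :
  qmat T -> qmat (col' j T).
Proof. by rewrite col'Esub; apply: qmat_sub => // x y; apply: lift_homo. Qed.

(** * Alternation in the rows *)

(** Isolates two consecutive factors of a noncommutative product. The outer
    factors u and v serve for all the functions that differ from F at i and i'
    only, so that several such products can be compared. *)
Lemma prod_adjacent (m : nat) (i i' : 'I_m) (F : 'I_m -> A) :
  i' = i.+1 :> nat ->
  exists u v, forall G : 'I_m -> A,
    (forall x, x != i -> x != i' -> G x = F x) ->
    \prod_x G x = u * (G i * G i') * v.
Proof.
case: i i' => i hi [i' hi'] /= e; subst i'.
have [b em] : exists b, m = (i + b.+2)%N by exists (m - i.+2)%N; lia.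
subst m; exists (\prod_x F (lshift _ x)).
exists (\prod_x F (rshift i (lift ord0 (lift ord0 x)))) => G hG.
rewrite big_split_ord /= !big_ord_recl !mulrA /=.
congr (_ * G _ * G _ * _); first by apply: eq_bigr => x _; apply: hG;
  rewrite -val_eqE /=; case: x => /= x; lia.
- by apply: val_inj => /=; rewrite addn0.
- by apply: val_inj => /=; rewrite addn1.
- by apply: eq_bigr => x _; apply: hG; rewrite -val_eqE /= /bump /=; lia.
Qed.

(** Pairs each permutation s that increases at (i, i') with its composite with
    the transposition of i and i', which has exactly one more inversion. The
    alternation properties then follow from 2 by 2 relations. *)
Lemma qdet_pair (m p : nat) (T : 'M[A]_(p, m)) (r : 'I_m -> 'I_p)
    (i i' : 'I_m) : i' = i.+1 :> nat ->
  qdet q (rowsub r T) = \sum_(s : 'S_m | (s i < s i')%N)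
    (- q) ^+ inversions s *:
      (\prod_x T (r x) (s x) - q *: \prod_x T (r x) (s (tperm i i' x))).
Proof.
move=> hi; have ne : i != i' by rewrite -val_eqE /= hi; lia.
rewrite /qdet (bigID (fun s : 'S_m => (s i < s i')%N)) /=.
rewrite [X in _ + X](reindex_inj (mulgI (tperm i i'))) /=.
rewrite [X in _ + X](eq_bigl (fun s : 'S_m => (s i < s i')%N)); last first.
  move=> s; rewrite !permM tpermL tpermR -leqNgt leq_eqVlt val_eqE.
  by rewrite (inj_eq perm_inj) (negbTE ne).
rewrite -big_split /=; apply: eq_bigr => s lt_s.
have -> : inversions (tperm i i' * s)%g = (inversions s).+1.
  rewrite -[inversions s]/(ninv (fun x => s x)) -(ninv_tperm hi lt_s).
  by apply: eq_card => x; rewrite !inE !permM.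
rewrite exprSr -scalerA -scalerDr scaleNr.
congr (_ *: (_ - _ *: _)); apply: eq_bigr => x _; rewrite !mxE ?permM //.
Qed.

Lemma qdet_adjacent_eq (m p : nat) (T : 'M[A]_(p, m)) (r : 'I_m -> 'I_p)
    (i i' : 'I_m) : qmat T -> i' = i.+1 :> nat -> r i = r i' ->
  qdet q (rowsub r T) = 0.
Proof.
move=> qT hi er; rewrite (qdet_pair _ _ hi) big1 // => s lt_s.
have [u [v huv]] := prod_adjacent (fun x => T (r x) (s x)) hi.
rewrite !huv // => [|x xi xi']; last by rewrite tpermD // eq_sym.
rewrite tpermL tpermR er (qmat_row qT _ lt_s).
by rewrite -scalerAr -scalerAl subrr scaler0.
Qed.

Lemma qdet_adjacent_swap (m p : nat) (T : 'M[A]_(p, m)) (r : 'I_m -> 'I_p)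
    (i i' : 'I_m) : q != 0 -> qmat T -> i' = i.+1 :> nat -> (r i < r i')%N ->
  qdet q (rowsub (fun x => r (tperm i i' x)) T) = - q *: qdet q (rowsub r T).
Proof.
move=> q0 qT hi lt_r; rewrite !(qdet_pair _ _ hi) scaler_sumr.
apply: eq_bigr => s lt_s; rewrite scalerA mulrC -scalerA; congr (_ *: _).
have [u [v huv]] := prod_adjacent (fun x => T (r x) (s x)) hi.
have off x : x != i -> x != i' -> tperm i i' x = x.
  by move=> xi xi'; rewrite tpermD // eq_sym.
rewrite !huv; try by move=> x xi xi'; rewrite ?(off x).
rewrite tpermL tpermR !(scalerAl _ _ v) -!mulrBl (scalerAl _ _ v).
rewrite !(scalerAr _ u) -!mulrBr (scalerAr _ u).
congr (_ * _ * _); rewrite (qmat_diag qT lt_r lt_s).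
rewrite (qmat_anti qT lt_r lt_s).
set x := T (r i') (s i) * T (r i) (s i').
set y := T (r i') (s i') * T (r i) (s i).
rewrite -addrA -scalerBl scalerDr scalerA.
rewrite (_ : - q * (q - q^-1 - q) = 1); last by field.
by rewrite scale1r addrC scaleNr.
Qed.

Hypothesis q0 : q != 0.

(** Sorting the rows ends with two equal adjacent rows. *)
Lemma qdet_repeat (m p : nat) (T : 'M[A]_(p, m)) (r : 'I_m -> 'I_p) :
  qmat T -> ~ injective r -> qdet q (rowsub r T) = 0.
Proof.
move=> qT; elim/adjacent_ind: r => [r mono|r i i' hi er _|r i i' hi lt_r IH].
- case=> x y e; apply: val_inj => /=.
  by case: (ltngtP x y) => // /mono; rewrite /= e ltnn.
- exact: qdet_adjacent_eq hi er.
- move=> ninj; rewrite qdet_adjacent_swap // IH ?scaler0 // => inj_r.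
  by apply: ninj => x y /inj_r/perm_inj.
Qed.

Lemma qdet_row_perm (m : nat) (T : 'M[A]_m) (s : 'S_m) :
  qmat T -> qdet q (row_perm s T) = (- q) ^+ inversions s *: qdet q T.
Proof.
move=> qT; rewrite -[inversions s]/(ninv (fun x => s x)).
have -> : row_perm s T = rowsub s T by apply/matrixP => x y; rewrite !mxE.
have : injective s by apply: perm_inj.
elim/adjacent_ind: (s : 'I_m -> 'I_m) => [r mono|r i i' hi er|r i i' hi lt_r IH] inj_r.
- have r1 : r = id.
    have e : perm inj_r = 1%g by apply: perm_ltn_homo => i j /mono; rewrite !permE.
    by apply: funext => x; rewrite -(permE inj_r) e perm1.
  rewrite r1 (_ : ninv _ = 0%N) ?scale1r; last first.
    by apply: eq_card0 => x; rewrite !inE; lia.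
  by congr (qdet _ _); apply/matrixP => x y; rewrite mxE.
- by move/inj_r: er hi => ->; lia.
- rewrite qdet_adjacent_swap // IH ?(ninv_tperm (f := fun x => r x) hi) //.
    by rewrite exprS scalerA.
  by move=> x y e; apply: (@perm_inj _ (tperm i i')); apply: inj_r; rewrite !tpermK.
Qed.

End QuantumMatrix.

(** * Expansions of a quantum determinant *)

Lemma sum_ltn_ord (n j : nat) : (\sum_(z < n) (z < j)%N)%N = minn n j.
Proof. by elim: n => [|n IH]; rewrite ?big_ord0 ?big_ord_recr /= ?IH; lia. Qed.

Lemma sum_geq_ord (n j : nat) : (\sum_(z < n) (j <= z)%N)%N = (n - j)%N.
Proof. by elim: n => [|n IH]; rewrite ?big_ord0 ?big_ord_recr /= ?IH; lia. Qed.

Lemma inversionsE (m : nat) (s : 'S_m) :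
  inversions s = (\sum_(x < m) \sum_(y < m) ((x < y) && (s y < s x)))%N.
Proof.
rewrite /inversions -sum1dep_card big_mkcond /= pair_bigA /=.
by apply: eq_bigr => -[x y] _ /=; case: ifP.
Qed.

Lemma ltn_bump (h x y : nat) : (bump h x < bump h y)%N = (x < y)%N.
Proof. by rewrite /bump; do 2 case: leqP => ? /=; lia. Qed.

(** The index 0, sent to j, is inverted with the j indices of smaller image. *)
Lemma inversions_lift_perm0 (n : nat) (j : 'I_n.+1) (s : 'S_n) :
  inversions (lift_perm ord0 j s) = (j + inversions s)%N.
Proof.
rewrite !inversionsE (bigD1_ord ord0) //=; congr (_ + _)%N.
  rewrite (bigD1_ord ord0) //= add0n.
  under eq_bigr do rewrite lift_perm_id lift_perm_lift.
  rewrite (reindex_inj (@perm_inj _ s^-1%g)) /=.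
  rewrite (eq_bigr (fun z : 'I_n => nat_of_bool (z < j)%N)).
    by rewrite sum_ltn_ord; have := ltn_ord j; lia.
  by move=> z _; rewrite permKV /= /bump; case: leqP; lia.
apply: eq_bigr => x _; rewrite (bigD1_ord ord0) //= add0n.
by apply: eq_bigr => y _; rewrite !lift_perm_lift /= !ltn_bump.
Qed.

(** The last index, sent to j, is inverted with the n - j indices of larger
    image. *)
Lemma inversions_lift_perm_max (n : nat) (j : 'I_n.+1) (s : 'S_n) :
  inversions (lift_perm ord_max j s) = (n - j + inversions s)%N.
Proof.
have lm (x : 'I_n) : lift ord_max x = x :> nat by exact: lift_max.
rewrite !inversionsE (bigD1_ord ord_max) //= big1 => [|y _]; last first.
  by have := ltn_ord y; lia.
rewrite add0n; under eq_bigr => x _ do rewrite (bigD1_ord ord_max) //=.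
rewrite big_split /=; congr (_ + _)%N.
  under eq_bigr do rewrite lift_perm_id lift_perm_lift.
  rewrite (reindex_inj (@perm_inj _ s^-1%g)) /=.
  rewrite (eq_bigr (fun z : 'I_n => nat_of_bool (j <= z)%N)) ?sum_geq_ord //.
  move=> z _; rewrite permKV /bump [(n <= _)%N]leqNgt ltn_ord add0n ltn_ord /=.
  by case: (leqP j z) => h; rewrite ?add1n ?add0n ?ltnS ?h // ltnNge (ltnW h).
apply: eq_bigr => x _; apply: eq_bigr => y _.
by rewrite !lift_perm_lift /= !ltn_bump.
Qed.

(** The permutations that send i0 to j0 are the lifts of the permutations of the
    other indices. *)
Lemma big_lift_perm (V : nmodType) (n : nat) (i0 j0 : 'I_n.+1)
    (F : 'S_n.+1 -> V) :
  \sum_(s : 'S_n.+1 | s i0 == j0) F s = \sum_(s : 'S_n) F (lift_perm i0 j0 s).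
Proof.
have lp_inj : injective (@lift_perm n i0 j0).
  move=> s t e; apply/permP => x; apply: (@lift_inj _ j0).
  by rewrite -!(lift_perm_lift i0) e.
have -> : \sum_(s : 'S_n) F (lift_perm i0 j0 s) =
    \sum_(s in [set: 'S_n]) F (lift_perm i0 j0 s).
  by apply: eq_bigl => s; rewrite inE.
rewrite -(big_imset (A := setT) F (in2W lp_inj)); apply: eq_big => s; last by [].
apply/idP/imsetP => [/eqP si0|[t _ ->]]; last by rewrite lift_perm_id.
have /fin_all_exists[f sf] x : exists y, s (lift i0 x) = lift j0 y.
  have : j0 != s (lift i0 x) by rewrite -si0 (inj_eq perm_inj) neq_lift.
  by case/unlift_some => y -> _; exists y.
have f_inj : injective f.
  by move=> x y e; apply/(@lift_inj _ i0)/(@perm_inj _ s); rewrite !sf e.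
exists (perm f_inj) => //; apply/permP => x.
case: (unliftP i0 x) => [y|] ->; rewrite ?lift_perm_id //.
by rewrite lift_perm_lift permE sf.
Qed.

Section Expansion.
Variables (k : fieldType) (q : k) (A : algType k).

Lemma qdet_expand_first (n : nat) (M : 'M[A]_n.+1) :
  qdet q M = \sum_(j < n.+1) (- q) ^+ j *: (M ord0 j * qdet q (row' ord0 (col' j M))).
Proof.
rewrite /qdet (partition_big (fun s : 'S_n.+1 => s ord0) predT) //=.
apply: eq_bigr => j _; rewrite big_lift_perm mulr_sumr scaler_sumr.
apply: eq_bigr => s _; rewrite inversions_lift_perm0 exprD -scalerA -scalerAr.
congr (_ *: (_ *: _)); rewrite big_ord_recl lift_perm_id; congr (_ * _).
by apply: eq_bigr => x _; rewrite !mxE -(lift_perm_lift ord0).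
Qed.

Lemma qdet_expand_last (n : nat) (M : 'M[A]_n.+1) :
  qdet q M = \sum_(j < n.+1) (- q) ^+ (n - j) *:
    (qdet q (row' ord_max (col' j M)) * M ord_max j).
Proof.
rewrite /qdet (partition_big (fun s : 'S_n.+1 => s ord_max) predT) //=.
apply: eq_bigr => j _; rewrite big_lift_perm mulr_suml scaler_sumr.
apply: eq_bigr => s _; rewrite inversions_lift_perm_max exprD -scalerA -scalerAl.
congr (_ *: (_ *: _)); rewrite big_ord_recr lift_perm_id; congr (_ * _).
apply: eq_bigr => x _; rewrite !mxE (_ : widen_ord _ x = lift ord_max x).
  by rewrite lift_perm_lift.
exact/val_inj/esym/lift_max.
Qed.

End Expansion.

(** * Laplace expansions along rows and columns of a quantum matrix *)

Section Laplace.
Variables (k : fieldType) (q : k) (A : algType k).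
Hypothesis q0 : q != 0.

Lemma inversions1 (m : nat) : inversions (1%g : 'S_m) = 0%N.
Proof. by apply: eq_card0 => x; rewrite !inE !perm1; lia. Qed.

(** The first-row expansion read from right to left: a row i combined with the
    minors on rows r gives the determinant with the row i put on top of r. The
    rows i and r are arbitrary, hence cofactors of the wrong row are covered. *)
Lemma expand_first_rowsub (m p : nat) (T : 'M[A]_(p, m.+1))
    (r : 'I_m -> 'I_p) (i : 'I_p) :
  \sum_(j < m.+1) (- q) ^+ j *: (T i j * qdet q (rowsub r (col' j T))) =
  qdet q (rowsub (fun x => oapp r i (unlift ord0 x)) T).
Proof.
rewrite qdet_expand_first; apply: eq_bigr => j _.
rewrite !mxE unlift_none /=; congr (_ *: (_ * qdet _ _)).
by apply/matrixP => x y; rewrite !mxE liftK.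
Qed.

Lemma expand_last_rowsub (m p : nat) (T : 'M[A]_(p, m.+1))
    (r : 'I_m -> 'I_p) (i : 'I_p) :
  \sum_(j < m.+1) (- q) ^+ (m - j) *: (qdet q (rowsub r (col' j T)) * T i j) =
  qdet q (rowsub (fun x => oapp r i (unlift ord_max x)) T).
Proof.
rewrite qdet_expand_last; apply: eq_bigr => j _.
rewrite !mxE unlift_none /=; congr (_ *: (qdet _ _ * _)).
by apply/matrixP => x y; rewrite !mxE liftK.
Qed.

Lemma oapp_unlift_ninj (m p : nat) (i0 : 'I_m.+1) (r : 'I_m -> 'I_p) x :
  ~ injective (fun y => oapp r (r x) (unlift i0 y)).
Proof.
move=> inj_r; case/eqP: (neq_lift i0 x); apply: inj_r.
by rewrite unlift_none liftK.
Qed.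

Lemma oapp_unlift_perm (m : nat) (i0 i : 'I_m.+1) x :
  oapp (lift i) i (unlift i0 x) = lift_perm i0 i 1%g x.
Proof.
by case: unliftP => [y|] ->; rewrite ?lift_perm_id // lift_perm_lift perm1.
Qed.

(** With i on top of the rows other than i', either a row is repeated or a cycle
    with i inversions moves i to its place. *)
Lemma laplace_first (n : nat) (T : 'M[A]_n.+1) (i i' : 'I_n.+1) : qmat q T ->
  \sum_(j < n.+1) (- q) ^+ j *: (T i j * qdet q (row' i' (col' j T))) =
  if i == i' then (- q) ^+ i *: qdet q T else 0.
Proof.
move=> qT; under eq_bigr do rewrite row'Esub.
rewrite expand_first_rowsub; case: eqP => [<-|/eqP].
  have -> : rowsub (fun x => oapp (lift i) i (unlift ord0 x)) T =
            row_perm (lift_perm ord0 i 1%g) T.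
    by apply/matrixP => x y; rewrite !mxE oapp_unlift_perm.
  by rewrite qdet_row_perm // inversions_lift_perm0 inversions1 addn0.
rewrite eq_sym => /unlift_some[y -> _].
by apply: qdet_repeat => //; apply: oapp_unlift_ninj.
Qed.

Lemma laplace_last (n : nat) (T : 'M[A]_n.+1) (i i' : 'I_n.+1) : qmat q T ->
  \sum_(j < n.+1) (- q) ^+ (n - j) *: (qdet q (row' i' (col' j T)) * T i j) =
  if i == i' then (- q) ^+ (n - i) *: qdet q T else 0.
Proof.
move=> qT; under eq_bigr do rewrite row'Esub.
rewrite expand_last_rowsub; case: eqP => [<-|/eqP].
  have -> : rowsub (fun x => oapp (lift i) i (unlift ord_max x)) T =
            row_perm (lift_perm ord_max i 1%g) T.
    by apply/matrixP => x y; rewrite !mxE oapp_unlift_perm.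
  by rewrite qdet_row_perm // inversions_lift_perm_max inversions1 addn0.
rewrite eq_sym => /unlift_some[y -> _].
by apply: qdet_repeat => //; apply: oapp_unlift_ninj.
Qed.

(** The sum is a determinant of size m+1 in which the row i occurs twice. *)
Lemma pluecker_first (m : nat) (T : 'M[A]_(m, m.+1)) (i : 'I_m) : qmat q T ->
  \sum_(j < m.+1) (- q) ^+ j *: (T i j * qdet q (col' j T)) = 0.
Proof.
move=> qT; have e j : col' j T = rowsub id (col' j T).
  by apply/matrixP => x y; rewrite !mxE.
under eq_bigr do rewrite e; rewrite expand_first_rowsub.
by apply: qdet_repeat => //; apply: (@oapp_unlift_ninj _ _ _ id).
Qed.

Lemma pluecker_last (m : nat) (T : 'M[A]_(m, m.+1)) (i : 'I_m) : qmat q T ->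
  \sum_(j < m.+1) (- q) ^+ (m - j) *: (qdet q (col' j T) * T i j) = 0.
Proof.
move=> qT; have e j : col' j T = rowsub id (col' j T).
  by apply/matrixP => x y; rewrite !mxE.
under eq_bigr do rewrite e; rewrite expand_last_rowsub.
by apply: qdet_repeat => //; apply: (@oapp_unlift_ninj _ _ _ id).
Qed.

Lemma lift0_lift (n : nat) (i : 'I_n.+1) (x : 'I_n) :
  lift (lift ord0 i) (lift ord0 x) = lift ord0 (lift i x).
Proof. by apply: val_inj; rewrite /= /bump; lia. Qed.

Lemma lift_lift0_0 (n : nat) (i : 'I_n.+1) : lift (lift ord0 i) ord0 = ord0.
Proof. exact: val_inj. Qed.

Lemma minor_tr (m n : nat) (T : 'M[A]_(m.+1, n.+1)) i j :
  row' j (col' i T^T) = (row' i (col' j T))^T.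
Proof. by apply/matrixP => x y; rewrite !mxE. Qed.

(** Both sides are expanded along the first row and then along the first column,
    in opposite orders, the inner expansions being available by induction. The
    products of an entry of the first row and an entry of the first column that
    appear are anti-diagonal pairs, which commute. *)
Lemma qdet_tr (n : nat) (T : 'M[A]_n) : qmat q T -> qdet q T^T = qdet q T.
Proof.
have [N] := ubnP n; elim: N n T => // N IH [T _ _|n T].
  by congr (qdet _ _); apply/matrixP => -[].
rewrite ltnS => nN qT; have IHn := IH n _ nN.
have col1 i : qdet q (row' ord0 (col' i T^T)) = qdet q (row' i (col' ord0 T)).
  by rewrite minor_tr IHn //; apply: qmat_row'; apply: qmat_col'.
rewrite !qdet_expand_first; under eq_bigr do rewrite col1 mxE.
rewrite !big_ord_recl /=; congr (_ + _).
case: n T nN qT IHn col1 => [|n] T nN qT IHn col1; first by rewrite !big_ord0.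
have IHn' := IH n _ (ltnW nN).
pose minor i j := qdet q (row' i (col' j (row' ord0 (col' ord0 T)))).
have sumj (i : 'I_n.+1) : qdet q (row' (lift ord0 i) (col' ord0 T)) =
    \sum_(j < n.+1) (- q) ^+ j *: (T ord0 (lift ord0 j) * minor i j).
  rewrite qdet_expand_first; apply: eq_bigr => j _.
  rewrite !mxE lift_lift0_0; congr (_ *: (_ * qdet _ _)).
  by apply/matrixP => x y; rewrite !mxE lift0_lift.
have sumi (j : 'I_n.+1) : qdet q (row' ord0 (col' (lift ord0 j) T)) =
    \sum_(i < n.+1) (- q) ^+ i *: (T (lift ord0 i) ord0 * minor i j).
  rewrite -IHn; last by apply: qmat_row'; apply: qmat_col'.
  rewrite qdet_expand_first; apply: eq_bigr => i _.
  rewrite !mxE lift_lift0_0 minor_tr IHn'; last first.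
    by apply: qmat_row'; apply: qmat_col'; apply: qmat_row'; apply: qmat_col'.
  congr (_ *: (_ * qdet _ _)).
  by apply/matrixP => x y; rewrite !mxE lift0_lift.
under eq_bigr do rewrite sumj mulr_sumr scaler_sumr.
under [RHS]eq_bigr do rewrite sumi mulr_sumr scaler_sumr.
rewrite exchange_big; apply: eq_bigr => j _; apply: eq_bigr => i _ /=.
rewrite -!scalerAr !scalerA !mulrA.
rewrite (qmat_anti qT (a := ord0) (b := lift ord0 i)) //.
by congr (_ *: _); rewrite -!exprD; congr (_ ^+ _); rewrite /bump /=; lia.
Qed.

Lemma laplace_last_col (n : nat) (T : 'M[A]_n.+1) (j j' : 'I_n.+1) :
  qmat q T ->
  \sum_(i < n.+1) (- q) ^+ (n - i) *: (qdet q (row' i (col' j' T)) * T i j) =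
  if j == j' then (- q) ^+ (n - j) *: qdet q T else 0.
Proof.
move=> qT; rewrite -(qdet_tr qT) -(laplace_last j j' (qmat_tr qT)).
apply: eq_bigr => i _; rewrite mxE minor_tr qdet_tr //.
by apply: qmat_row'; apply: qmat_col'.
Qed.

Lemma laplace_first_col (n : nat) (T : 'M[A]_n.+1) (j j' : 'I_n.+1) :
  qmat q T ->
  \sum_(i < n.+1) (- q) ^+ i *: (T i j * qdet q (row' i (col' j' T))) =
  if j == j' then (- q) ^+ j *: qdet q T else 0.
Proof.
move=> qT; rewrite -(qdet_tr qT) -(laplace_first j j' (qmat_tr qT)).
apply: eq_bigr => i _; rewrite mxE minor_tr qdet_tr //.
by apply: qmat_row'; apply: qmat_col'.
Qed.

(** If C is the adjugate of T, then T C and C T are both scalar matrices with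
    the determinant d on the diagonal, so d T = T C T = T d. The weights in S
    are those for which the row expansion evaluates T C and the column expansion
    evaluates C T. *)
Lemma qdet_comm (n : nat) (T : 'M[A]_n) (i j : 'I_n) : qmat q T ->
  qdet q T * T i j = T i j * qdet q T.
Proof.
case: n T i j => [? []//|n] T i j qT.
have qn0 : (- q) ^+ n != 0 by rewrite expf_neq0 ?oppr_eq0.
apply: (scalerI qn0); pose C x y := qdet q (row' x (col' y T)).
pose S := \sum_(b < n.+1) \sum_(c < n.+1)
  ((- q) ^+ b * (- q) ^+ (n - c)) *: (T i b * C c b * T c j).
have split_n (x : 'I_n.+1) : (- q) ^+ x * (- q) ^+ (n - x) = (- q) ^+ n.
  by rewrite -exprD subnKC // -ltnS.
transitivity S; last first.
  rewrite /S (bigD1 j) //= [X in _ + X]big1 ?addr0 => [|b bj].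
    rewrite -(split_n j) -scalerA scalerAr.
    have := laplace_last_col j j qT; rewrite eqxx => <-.
    rewrite mulr_sumr scaler_sumr; apply: eq_bigr => c _.
    by rewrite -scalerA -scalerAr mulrA.
  have := laplace_last_col j b qT; rewrite eq_sym (negbTE bj) => e.
  transitivity ((- q) ^+ b *: (T i b * 0)); last by rewrite mulr0 scaler0.
  rewrite -[X in T i b * X]e mulr_sumr scaler_sumr; apply: eq_bigr => c _.
  by rewrite -scalerA -scalerAr mulrA.
rewrite /S exchange_big (bigD1 i) //= [X in _ + X]big1 ?addr0 => [|c ci].
  rewrite -(split_n i) mulrC -scalerA scalerAl.
  have := laplace_first i i qT; rewrite eqxx => <-.
  rewrite mulr_suml scaler_sumr; apply: eq_bigr => b _.
  by rewrite mulrC -scalerA -scalerAl.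
have := laplace_first i c qT; rewrite eq_sym (negbTE ci) => e.
transitivity ((- q) ^+ (n - c) *: (0 * T c j)); last by rewrite mul0r scaler0.
rewrite -[X in X * T c j]e mulr_suml scaler_sumr; apply: eq_bigr => b _.
by rewrite mulrC -scalerA -scalerAl.
Qed.

End Laplace.

(** * Sets closed under the Ore operations of a quantum minor *)

Section OreClosed.
Variables (k : fieldType) (q : k) (A : algType k).
Hypothesis q0 : q != 0.

(** The properties of the set of Ore elements for D that hold on both sides. The
    left Ore elements satisfy the cancellation rule because of D x, the right
    ones because of x D. *)
Record ore_closed (D : A) (P : A -> Prop) : Prop := OreClosed {
  ore_closedD x y : P x -> P y -> P (x + y);
  ore_closedM x y : P x -> P y -> P (x * y);
  ore_closed_qcomm c y : c != 0 -> D * y = c *: (y * D) -> P y;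
  ore_closed_cancel x : P (D * x) -> P (x * D) -> P x }.

Section Closure.
Variables (D : A) (P : A -> Prop).
Hypothesis cP : ore_closed D P.

Lemma ore_closed_comm y : D * y = y * D -> P y.
Proof.
by move=> e; apply: (ore_closed_qcomm cP (oner_neq0 k)); rewrite scale1r.
Qed.

Lemma ore_closedZ c x : P x -> P (c *: x).
Proof.
move=> Px; rewrite -mulr_algl; apply: (ore_closedM cP) => //.
by apply: ore_closed_comm; rewrite mulr_algl mulr_algr.
Qed.

Lemma ore_closed_sum (I : finType) (Q : pred I) (F : I -> A) :
  (forall i, Q i -> P (F i)) -> P (\sum_(i | Q i) F i).
Proof.
move=> hF; apply: big_ind => //; last exact: ore_closedD cP.
by apply: ore_closed_comm; rewrite mulr0 mul0r.
Qed.

(** A linear relation whose other terms lie in P puts in P every term that has a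
    nonzero coefficient. *)
Lemma ore_closed_solve (I : finType) (i0 : I) (a : I -> k) (x : I -> A) y :
  \sum_i a i *: x i = y -> a i0 != 0 -> P y ->
  (forall i, i != i0 -> P (x i)) -> P (x i0).
Proof.
rewrite (bigD1 i0) //= => e a0 Py Px.
have -> : x i0 = (a i0)^-1 *: (y + -1 *: \sum_(i | i != i0) a i *: x i).
  by rewrite scaleN1r -e addrK scalerA mulVf // scale1r.
apply: ore_closedZ; apply: (ore_closedD cP) => //.
apply: ore_closedZ; apply: ore_closed_sum => i ii0.
by apply: ore_closedZ; apply: Px.
Qed.

End Closure.

Lemma commr_qdet (m : nat) (D : A) (M : 'M[A]_m) :
  (forall i j, D * M i j = M i j * D) -> D * qdet q M = qdet q M * D.
Proof.
move=> hD; apply: commr_sum => s _.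
have : GRing.comm D (\prod_(i < m) M i (s i)).
  by apply: commr_prod => i _; apply: hD.
by rewrite /GRing.comm -scalerAr -scalerAl => ->.
Qed.

(** Expand the second minor along the column a, with cofactors M i that omit
    both columns a and b. In each product of the first minor and T i a, the
    relation pluecker_last replaces a by the other columns c; the sum over i is
    then an expansion with the column a replaced by c. It vanishes by repetition
    unless c = b, where it is the first minor again. *)
Lemma qcomm_maximal_minors (m : nat) (T : 'M[A]_(m, m.+1)) (a b : 'I_m.+1) :
  qmat q T -> exists2 c, c != 0 &
    qdet q (col' a T) * qdet q (col' b T) =
    c *: (qdet q (col' b T) * qdet q (col' a T)).
Proof.
have Nq0 e : (- q) ^+ e != 0 by rewrite expf_neq0 ?oppr_eq0.
move=> qT; case: (eqVneq a b) => [<-|ab].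
  by exists 1; rewrite ?oner_neq0 ?scale1r.
case: m a b T ab qT => [|m] a b T ab qT.
  by rewrite (ord1 a) (ord1 b) eqxx in ab.
have [a' ea _] : {a' | a = lift b a' & unlift b a = Some a'}.
  by apply: unlift_some; rewrite eq_sym.
have [b' eb _] := unlift_some ab.
(* Omitting b and then a, or a and then b, leaves the same columns. *)
have col2 : col' a' (col' b T) = col' b' (col' a T).
  apply/matrixP => x y; rewrite !mxE; congr (T _ _); apply: val_inj => /=.
  move: (congr1 val ea) (congr1 val eb) => /=; rewrite /bump; lia.
pose M i := qdet q (row' i (col' a' (col' b T))).
have qa := qmat_col' a qT; have qb := qmat_col' b qT.
have Eb : (- q) ^+ a' *: qdet q (col' b T) =
    \sum_(i < m.+1) (- q) ^+ i *: (T i a * M i).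
  have := laplace_first_col q0 a' a' qb; rewrite eqxx => <-.
  by apply: eq_bigr => i _; rewrite mxE -ea.
have Ea c : c != a -> \sum_(i < m.+1) (- q) ^+ i *: (T i c * M i) =
    if c == b then (- q) ^+ b' *: qdet q (col' a T) else 0.
  move=> ca; case: (eqVneq c b) => [->|cb].
    have := laplace_first_col q0 b' b' qa; rewrite eqxx => <-.
    by apply: eq_bigr => i _; rewrite mxE -eb /M col2.
  have [c' ec _] : {c' | c = lift b c' & unlift b c = Some c'}.
    by apply: unlift_some; rewrite eq_sym.
  have c'a' : c' != a' by apply: contraNneq ca => e; rewrite ec e ea.
  have := laplace_first_col q0 c' a' qb; rewrite (negbTE c'a') => e.
  by apply: etrans e; apply: eq_bigr => i _; rewrite mxE -ec.
have Pl i : (- q) ^+ (m.+1 - a) *: (qdet q (col' a T) * T i a) =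
    - \sum_(c | c != a) (- q) ^+ (m.+1 - c) *: (qdet q (col' c T) * T i c).
  have /eqP := pluecker_last q0 i qT.
  by rewrite (bigD1 a) //= addr_eq0 => /eqP.
exists (((- q) ^+ (m.+1 - a) * (- q) ^+ a')^-1 *
        - ((- q) ^+ (m.+1 - b) * (- q) ^+ b')).
  by rewrite mulf_neq0 ?invr_eq0 ?oppr_eq0 ?mulf_neq0.
have k0 : (- q) ^+ (m.+1 - a) * (- q) ^+ a' != 0 by rewrite mulf_neq0.
apply: (scalerI k0); rewrite [RHS]scalerA mulrA divff // mul1r.
rewrite -scalerA scalerAr Eb mulr_sumr scaler_sumr.
transitivity (- \sum_(c | c != a) (- q) ^+ (m.+1 - c) *: (qdet q (col' c T) *
    \sum_(i < m.+1) (- q) ^+ i *: (T i c * M i))).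
  under [in RHS]eq_bigr do rewrite mulr_sumr scaler_sumr.
  rewrite exchange_big -sumrN; apply: eq_bigr => i _ /=.
  rewrite -scalerAr scalerA mulrC -scalerA mulrA scalerAl Pl mulNr scalerN.
  rewrite mulr_suml scaler_sumr; congr (- _); apply: eq_bigr => c _.
  by rewrite -!scalerAl -scalerAr !scalerA mulrA mulrC.
rewrite (bigD1 b) /= 1?eq_sym // Ea 1?eq_sym // eqxx.
rewrite big1 ?addr0 => [|c /andP[ca cb]]; last first.
  by rewrite Ea // (negbTE cb) mulr0 scaler0.
by rewrite -scalerAr scalerA scaleNr.
Qed.

Lemma ore_closed_rect (m : nat) (T : 'M[A]_(m, m.+1)) (j0 : 'I_m.+1)
    (P : A -> Prop) :
  qmat q T -> ore_closed (qdet q (col' j0 T)) P ->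
  (forall j, P (qdet q (col' j T))) /\ (forall i j, P (T i j)).
Proof.
have Nq0 e : (- q) ^+ e != 0 by rewrite expf_neq0 ?oppr_eq0.
move=> qT cP; have Pdet j : P (qdet q (col' j T)).
  have [c c0 e] := qcomm_maximal_minors j0 j qT.
  exact: (ore_closed_qcomm cP c0 e).
have Pin i j : j != j0 -> P (T i j).
  rewrite eq_sym => /unlift_some[j' -> _]; apply: (ore_closed_comm cP).
  by have := qdet_comm q0 i j' (qmat_col' j0 qT); rewrite mxE.
have P0 : P 0 by apply: (ore_closed_comm cP); rewrite mulr0 mul0r.
split=> // i j; case: (eqVneq j j0) => [->|]; last exact: Pin.
apply: (ore_closed_cancel cP).
  apply: (ore_closed_solve cP (i0 := j0)
    (x := fun j => qdet q (col' j T) * T i j) (pluecker_last q0 i qT)) => // j' ?.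
  by apply: (ore_closedM cP) => //; apply: Pin.
apply: (ore_closed_solve cP (i0 := j0)
  (x := fun j => T i j * qdet q (col' j T)) (pluecker_first q0 i qT)) => // j' ?.
by apply: (ore_closedM cP) => //; apply: Pin.
Qed.

(** For (i0, j0) itself, the expansion of the full determinant along the row i0
    isolates T i0 j0; all the other entries lie in a matrix with one row or one
    column less. *)
Lemma ore_closed_square (m : nat) (T : 'M[A]_m.+1) (i0 j0 : 'I_m.+1)
    (P : A -> Prop) :
  qmat q T -> ore_closed (qdet q (row' i0 (col' j0 T))) P ->
  forall i j, P (T i j).
Proof.
have Nq0 e : (- q) ^+ e != 0 by rewrite expf_neq0 ?oppr_eq0.
move=> qT cP.
have row_col j : col' j (row' i0 T) = row' i0 (col' j T).
  by apply/matrixP => x y; rewrite !mxE.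
have [] := @ore_closed_rect m (row' i0 T) j0 P (qmat_row' i0 qT).
  by rewrite row_col.
move=> Pdet Prow; have {}Pdet j : P (qdet q (row' i0 (col' j T))).
  by rewrite -row_col.
have [] := @ore_closed_rect m (col' j0 T)^T i0 P (qmat_tr (qmat_col' j0 qT)).
  have -> : col' i0 (col' j0 T)^T = (row' i0 (col' j0 T))^T.
    by apply/matrixP => x y; rewrite !mxE.
  by rewrite qdet_tr //; apply: qmat_row'; apply: qmat_col'.
move=> _ Pcol.
have Poff i j : (i != i0) || (j != j0) -> P (T i j).
  case/orP; rewrite eq_sym => /unlift_some[x -> _].
    by have := Prow x j; rewrite mxE.
  by have := Pcol x i; rewrite !mxE.
have Pd : P (qdet q T).
  apply: (ore_closed_comm cP); apply/esym/commr_qdet => x y.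
  by rewrite !mxE qdet_comm.
move=> i j; case: (altP (i =P i0)) => [->|ii0]; last by apply: Poff; rewrite ii0.
case: (altP (j =P j0)) => [->|jj0]; last by apply: Poff; rewrite jj0 orbT.
apply: (ore_closed_cancel cP).
  have := laplace_last q0 i0 i0 qT; rewrite eqxx => e.
  apply: (ore_closed_solve cP (i0 := j0)
    (x := fun j => qdet q (row' i0 (col' j T)) * T i0 j) e) => //.
    exact: ore_closedZ cP _ _ Pd.
  by move=> j' h; apply: (ore_closedM cP) => //; apply: Poff; rewrite h orbT.
have := laplace_first q0 i0 i0 qT; rewrite eqxx => e.
apply: (ore_closed_solve cP (i0 := j0)
  (x := fun j => T i0 j * qdet q (row' i0 (col' j T))) e) => //.
  exact: ore_closedZ cP _ _ Pd.
by move=> j' h; apply: (ore_closedM cP) => //; apply: Poff; rewrite h orbT.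
Qed.

(** The increasing enumeration of a set extends to one of the set with one
    element more. *)
Lemma insert_homo (m n : nat) (f : 'I_m -> 'I_n) (i : 'I_n) :
  {homo f : x y / (val x < val y)%N} -> (forall x, f x != i) ->
  exists i0 (f' : 'I_m.+1 -> 'I_n), [/\ {homo f' : x y / (val x < val y)%N},
    f' i0 = i & forall x, f' (lift i0 x) = f x].
Proof.
move=> hf fi.
pose Q c := [forall x : 'I_m, (c <= x)%N ==> (i <= f x)%N].
have Qm : exists c, Q c.
  by exists m; apply/forallP => x; rewrite leqNgt ltn_ord.
have [c /forallP Qc minc] := ex_minnP Qm.
have cm : (c < m.+1)%N.
  by apply: minc; apply/forallP => x; rewrite leqNgt ltn_ord.
have lt_c (x : 'I_m) : (x < c)%N -> (f x < i)%N.
  move=> xc; rewrite ltnNge; apply/negP => ix.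
  suff /minc : Q x by rewrite leqNgt xc.
  apply/forallP => y; apply/implyP; rewrite leq_eqVlt => /orP[/eqP/val_inj <- //|].
  by move/hf; apply: leq_trans => /=; lia.
have ge_c (x : 'I_m) : (c <= x)%N -> (i < f x)%N.
  by move=> cx; have := implyP (Qc x) cx; have := fi x; rewrite -val_eqE /=; lia.
(* The new element i goes to the first position c with only larger values of f
   from there on. *)
exists (Ordinal cm), (fun y => oapp f i (unlift (Ordinal cm) y)).
split=> [x y||x]; rewrite ?unlift_none ?liftK //=.
case: unliftP => [x'|] ->; case: unliftP => [y'|] -> /=; rewrite ?ltnn //.
- by rewrite ltn_bump => /hf.
- by move=> h; apply: lt_c; move: h; rewrite /bump; lia.
- by move=> h; apply: ge_c; move: h; rewrite /bump; lia.
Qed.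

Lemma ore_closed_minor (m n p : nat) (T : 'M[A]_(n, p))
    (f : 'I_m -> 'I_n) (g : 'I_m -> 'I_p) (P : A -> Prop) :
  {homo f : x y / (val x < val y)%N} -> {homo g : x y / (val x < val y)%N} ->
  qmat q T -> ore_closed (qdet q (mxsub f g T)) P -> forall i j, P (T i j).
Proof.
move=> hf hg qT cP i j.
case: (EM (exists x, f x = i)) => [[x <-]|hi].
  case: (EM (exists y, g y = j)) => [[y <-]|hj].
    apply: (ore_closed_comm cP).
    by have := qdet_comm q0 x y (qmat_sub hf hg qT); rewrite mxE.
  have [|j0 [g' [hg' <- eg]]] := insert_homo (i := j) hg.
    by move=> y; apply/eqP => e; apply: hj; exists y.
  have [|_] := @ore_closed_rect m (mxsub f g' T) j0 P (qmat_sub hf hg' qT).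
    have -> // : col' j0 (mxsub f g' T) = mxsub f g T.
    by apply/matrixP => ? ?; rewrite !mxE eg.
  by move/(_ x j0); rewrite mxE.
have [|i0 [f' [hf' <- ef]]] := insert_homo (i := i) hf.
  by move=> x; apply/eqP => e; apply: hi; exists x.
case: (EM (exists y, g y = j)) => [[y <-]|hj].
  have qs := qmat_sub hf' hg qT.
  have [|_] := @ore_closed_rect m (mxsub f' g T)^T i0 P (qmat_tr qs).
    have -> : col' i0 (mxsub f' g T)^T = (mxsub f g T)^T.
      by apply/matrixP => ? ?; rewrite !mxE ef.
    by rewrite qdet_tr //; apply: qmat_sub.
  by move/(_ y i0); rewrite !mxE.
have [|j0 [g' [hg' <- eg]]] := insert_homo (i := j) hg.
  by move=> y; apply/eqP => e; apply: hj; exists y.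
have := @ore_closed_square m (mxsub f' g' T) i0 j0 P (qmat_sub hf' hg' qT).
have -> : row' i0 (col' j0 (mxsub f' g' T)) = mxsub f g T.
  by apply/matrixP => ? ?; rewrite !mxE ef eg.
by move/(_ cP i0 j0); rewrite mxE.
Qed.

End OreClosed.

(** * From closed sets to Ore sets *)

Section OreElements.
Variables (R : pzRingType) (D : R).

(** Asking this for all N, and not only for N = 1, makes the set closed under
    products. *)
Definition ore_element (x : R) : Prop :=
  forall N, exists M r, D ^+ M * x = r * D ^+ N.

Lemma ore_elementM x y : ore_element x -> ore_element y -> ore_element (x * y).
Proof.
move=> hx hy N; have [M [y' ey]] := hy N; have [M' [x' ex]] := hx M.
by exists M', (x' * y'); rewrite mulrA ex -mulrA ey mulrA.
Qed.

Lemma ore_elementD x y : ore_element x -> ore_element y -> ore_element (x + y).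
Proof.
move=> hx hy N; have [M [x' ex]] := hx N; have [M' [y' ey]] := hy N.
exists (M' + M)%N, (D ^+ M' * x' + D ^+ M * y').
by rewrite mulrDr {2}addnC !exprD -!mulrA ex ey mulrDl !mulrA.
Qed.

Lemma ore_element_mull x : ore_element (D * x) -> ore_element x.
Proof.
move=> h N; have [M [r e]] := h N.
by exists M.+1, r; rewrite exprSr -mulrA.
Qed.

Lemma ore_element_qcomm z y :
  (forall x, z * x = x * z) -> D * y = z * (y * D) -> ore_element y.
Proof.
move=> cz e N; exists N, (z ^+ N * y); elim: N => [|N IH].
  by rewrite !expr0 !mul1r mulr1.
rewrite exprSr -mulrA e mulrA -cz -mulrA [D ^+ N * _]mulrA IH.
by rewrite (exprS z) -!mulrA.
Qed.

Lemma powers_mul_subset : mul_subset (powers D).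
Proof.
split=> [|_ _ [N ->] [M ->]]; first by exists 0%N.
by exists (N + M)%N; rewrite exprD.
Qed.

Lemma left_ore_powers : (forall x, ore_element x) -> left_ore_set (powers D).
Proof.
move=> h; split; first exact: powers_mul_subset.
move=> _ x [N ->]; have [M [r e]] := h x N.
by exists (D ^+ M), r; split=> //; exists M.
Qed.

End OreElements.

Section OreAlgebra.
Variables (k : fieldType) (A : algType k) (D : A).

Lemma ore_closed_left : ore_closed D (@ore_element A D).
Proof.
split=> [x y|x y|c y _ e|x h _].
- exact: ore_elementD.
- exact: ore_elementM.
- apply: (@ore_element_qcomm _ _ c%:A); first by move=> x; rewrite mulr_algl mulr_algr.
  by rewrite mulr_algl.
- exact: ore_element_mull.
Qed.

Lemma ore_closed_right : ore_closed D (@ore_element A^c D).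
Proof.
split=> [x y|x y hx hy|c y c0 e|x _ h].
- exact: (@ore_elementD A^c).
- exact: (@ore_elementM A^c D y x hy hx).
- apply: (@ore_element_qcomm A^c D c^-1%:A y) => [x|].
    by rewrite /GRing.mul /= mulr_algl mulr_algr.
  change (y * D = D * y * c^-1%:A).
  by rewrite mulr_algr e scalerA mulVf // scale1r.
- exact: (@ore_element_mull A^c).
Qed.

End OreAlgebra.

(** The algebra is spanned by the images of words in the generators. *)
Lemma qmatrix_ind (k : fieldType) (n : nat) (q : k) (P : qmatrix n q -> Prop) :
  P 1 -> (forall c x, P x -> P (c *: x)) ->
  (forall x y, P x -> P y -> P (x + y)) ->
  (forall x y, P x -> P y -> P (x * y)) ->
  (forall i j, P (qmx_gen q i j)) -> forall x, P x.
Proof.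
move=> P1 PZ PD PM Pg x; have [u ->] := @alg_piP k _ _ (@qmx_proper k n q) x.
set I := ('I_n * 'I_n)%type in u *; pose pi := @alg_pi k _ _ (@qmx_proper k n q).
have P0 : P 0 by rewrite -(scale0r 1); apply: PZ.
have PpiZ c v : P (pi v) -> P (pi (c *: v)) by rewrite /pi linearZ; apply: PZ.
have Pm (m : {fmonom I}) :
    P (pi (<< m >> : {malg k[{fmonom I}]})).
  case: m => s; elim: s => [|[i j] s IH].
    rewrite -fmoneE; exact: P1.
  have -> : (<< FMonom ((i, j) :: s) >> : {malg k[{fmonom I}]}) =
      free_mx k i j * (<< FMonom s >> : {malg k[{fmonom I}]}).
    rewrite /free_mx /free_gen malgM_def fgmulUU mulr1; congr << _ >>.
    by rewrite fmuE [RHS]fmmulE.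
  rewrite /pi rmorphM; apply: PM => //; exact: Pg.
rewrite [u]monalgE raddf_sum; apply: big_ind => // m _.
have -> : << u@_m *g m >> = u@_m *: (<< m >> : {malg k[{fmonom I}]}).
  by apply/malgP => m'; rewrite mcoeffZ !mcoeffU mulr_natr.
exact: PpiZ.
Qed.

Lemma qmat_gen (k : fieldType) (n : nat) (q : k) :
  qmat q (\matrix_(i < n, j < n) qmx_gen q i j).
Proof.
have rel := @qmx_gen_rel k n q.
split=> [a c d h|a b c h|a b c d h h'|a b c d h h']; rewrite !mxE;
  apply/eqP; rewrite -subr_eq0 ?opprD ?addrA; apply/eqP/rel.
- exact: qmx_row.
- exact: qmx_col.
- exact: qmx_diag.
- exact: qmx_anti.
Qed.

Theorem mainTheorem1 (k : fieldType) (char0 : [pchar k] =i pred0)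
    (q : k) (q_neq0 : q != 0) (n : nat) (n_gt0 : (0 < n)%N)
    (K L : {set 'I_n}) (eqKL : #|K| = #|L|) :
  ore_set (powers (qminor q eqKL)).
Proof.
set D := qminor q eqKL.
have all_closed (P : qmatrix n q -> Prop) : ore_closed D P -> forall x, P x.
  move=> cP; apply: qmatrix_ind.
  - by apply: (ore_closed_comm cP); rewrite mulr1 mul1r.
  - exact: ore_closedZ cP.
  - exact: ore_closedD cP.
  - exact: ore_closedM cP.
  - move=> i j; have [hf hg] := (@enum_val_ltn n K, @enum_val_ltn n L).
    have := ore_closed_minor q_neq0 _ _ (qmat_gen n q) cP i j.
    by rewrite mxE; apply=> x y; [apply: hf | move=> xy; apply: hg].
split.
  by apply: left_ore_powers; apply: all_closed; apply: ore_closed_left.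
(* The powers of D are the same in the opposite ring. *)
have eP : powers D = @powers (qmatrix n q)^c D.
  by apply: funext => x; rewrite /powers; under eq_exists do rewrite -revrX.
rewrite eP; apply: left_ore_powers; apply: all_closed; exact: ore_closed_right.
Qed.
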